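(* Let $k$ be a positive integer. An oriented graph with underlying graph the hypercube $Q_k$ and optimum Hermitian energy is unique up to switching equivalence; that is, if $Q_k^{\phi_1}$ and $Q_k^{\phi_2}$ are two oriented graphs obtained by orienting all edges of $Q_k$, and both have optimum Hermitian energy, then $Q_k^{\phi_1}$ and $Q_k^{\phi_2}$ are switching equivalent.
   Context: The hypercube $Q_k$ is defined recursively by $Q_1=K_2$ and $Q_k=Q_{k-1}\Box Q_1$ (Cartesian product) for $k\ge 2$. It is $k$-regular on $n=2^k$ vertices. An oriented graph $G^\phi$ is obtained from a finite simple undirected graph $G$ (its underlying graph) by giving every edge an orientation; $u\to v$ denotes an arc. Its Hermitian-adjacency matrix $H(G^\phi)=(h_{kl})$ has $h_{kl}=i$ and $h_{lk}=-i$ if $k\to l$, and $h_{kl}=0$ if $k,l$ are not adjacent, where $i$ is the imaginary unit. The Hermitian energy $\mathcal{E}_H(G^\phi)$ is the sum of the absolute values of the eigenvalues of $H(G^\phi)$. A graph $G^\phi$ on $n$ vertices with maximum degree $\Delta$ has optimum Hermitian energy if $\mathcal{E}_H(G^\phi)=n\sqrt{\Delta}$; for underlying graph $Q_k$ this means $\mathcal{E}_H=2^k\sqrt{k}$. Two oriented graphs $G^{\phi_1},G^{\phi_2}$ with the same underlying graph and the same vertex set are switching equivalent if there is a diagonal matrix $D$ with all diagonal entries in $\{1,-1\}$ such that $H(G^{\phi_2})=D^{-1}H(G^{\phi_1})D$. *)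

(* Defs.v *)
From HB Require Import structures.
From mathcomp Require Import all_boot all_order all_algebra.

Set Implicit Arguments.
Unset Strict Implicit.
Unset Printing Implicit Defensive.

Import Order.TTheory GRing.Theory Num.Theory.
Local Open Scope ring_scope.

Record sgraph := SGraph {
  vertex :> finType;
  edge : rel vertex;
  edge_sym : symmetric edge;
  edge_irrefl : irreflexive edge }.

Definition degree (G : sgraph) (u : G) : nat := #|[set v | edge u v]|.

Definition max_degree (G : sgraph) : nat := \max_(u : G) degree u.

Section CompleteGraph.
Variable n : nat.

Definition complete_edge : rel 'I_n := fun u v => u != v.

Lemma complete_edge_sym : symmetric complete_edge.
Proof. by move=> u v; rewrite /complete_edge eq_sym. Qed.

Lemma complete_edge_irrefl : irreflexive complete_edge.
Proof. by move=> u; rewrite /complete_edge eqxx. Qed.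

Definition complete_graph : sgraph :=
  SGraph complete_edge_sym complete_edge_irrefl.

End CompleteGraph.

Section CartesianProduct.
Variables G1 G2 : sgraph.

Definition cart_edge : rel (G1 * G2)%type := fun u v =>
  (u.1 == v.1) && edge u.2 v.2 || (u.2 == v.2) && edge u.1 v.1.

Lemma cart_edge_sym : symmetric cart_edge.
Proof.
by move=> u v; rewrite /cart_edge ![v.1 == _]eq_sym ![v.2 == _]eq_sym
                       ![edge v.1 _]edge_sym ![edge v.2 _]edge_sym.
Qed.

Lemma cart_edge_irrefl : irreflexive cart_edge.
Proof. by move=> u; rewrite /cart_edge !edge_irrefl !andbF. Qed.

Definition cart_prod : sgraph := SGraph cart_edge_sym cart_edge_irrefl.

End CartesianProduct.

(* Q_1 = K_2 and Q_k = Q_(k-1) [] Q_1 for k >= 2. The value K_1 at k = 0 only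
   makes the function total. *)
Fixpoint hypercube (k : nat) : sgraph :=
  match k with
  | 0 => complete_graph 1
  | 1 => complete_graph 2
  | k'.+1 => cart_prod (hypercube k') (complete_graph 2)
  end.

(* An oriented graph with underlying graph G: each edge {u, v} carries exactly
   one of the arcs u -> v, v -> u, and there are no other arcs. *)
Record orientation (G : sgraph) := Orientation {
  arc : rel G;
  arc_edge : forall u v : G, edge u v = arc u v || arc v u;
  arc_asym : forall u v : G, ~~ (arc u v && arc v u) }.

Section HermitianEnergy.
Variable C : numClosedFieldType.

(* Rows and columns follow the enumeration of the vertices given by
   enum_val : 'I_#|G| -> G. *)
Definition herm_adj (G : sgraph) (phi : orientation G) : 'M[C]_#|G| :=
  \matrix_(k, l) if arc phi (enum_val k) (enum_val l) then 'i
                 else if arc phi (enum_val l) (enum_val k) then - 'i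
                 else 0.

(* Eigenvalues counted with algebraic multiplicity: a sequence rs such that
   char_poly A = \prod_(z <- rs) ('X - z%:P); it is unique up to order. *)
Definition eigenvalues (n : nat) (A : 'M[C]_n) : seq C :=
  sval (closed_field_poly_normal (char_poly A)).

Definition herm_energy (G : sgraph) (phi : orientation G) : C :=
  \sum_(z <- eigenvalues (herm_adj phi)) `|z|.

Definition optimum_energy (G : sgraph) (phi : orientation G) : Prop :=
  herm_energy phi = #|G|%:R * sqrtC (max_degree G)%:R.

Definition switching_equivalent (G : sgraph) (phi1 phi2 : orientation G) :
    Prop :=
  exists D : 'M[C]_#|G|,
    [/\ is_diag_mx D, forall j, D j j = 1 \/ D j j = -1
      & herm_adj phi2 = invmx D *m herm_adj phi1 *m D].

End HermitianEnergy.

(* Main.v *)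
(* Writing H for the Hermitian-adjacency matrix, tr H^2 is the sum of the
   degrees, so optimum energy is the equality case of Cauchy-Schwarz for the
   |eigenvalues|: all of them equal sqrt Delta, hence H^2 = Delta I. For
   distinct u, w, the (u, w) entry of H^2 sums over the common neighbours of
   u and w; in a hypercube there are at most two, so this entry fixes the parity
   of the orientation of every 4-cycle. Two optimum orientations therefore
   differ by a sign function on the edges whose product around every 4-cycle
   is 1, and such a function on a hypercube is a coboundary: extend a potential
   from one facet to the opposite one along the edges joining them. *)
Require Import Defs.
From mathcomp Require Import all_boot all_order all_algebra.

Set Implicit Arguments.
Unset Strict Implicit.
Unset Printing Implicit Defensive.

Import Order.TTheory GRing.Theory Num.Theory.
Local Open Scope ring_scope.

(* [path.arc] shadows the arcs of an orientation. *)
Local Notation arc := Defs.arc.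

(** * Spectra of Hermitian matrices *)

Lemma char_poly_invmx_conj (R : comUnitRingType) n (P A : 'M[R]_n) :
  P \in unitmx -> char_poly (invmx P *m A *m P) = char_poly A.
Proof.
move=> Punit; rewrite /char_poly /char_poly_mx.
have invPP : map_mx polyC (invmx P) *m map_mx polyC P = 1%:M.
  by rewrite -map_mxM mulVmx // map_mx1.
have -> : 'X%:M - map_mx polyC (invmx P *m A *m P) =
    map_mx polyC (invmx P) *m ('X%:M - map_mx polyC A) *m map_mx polyC P.
  rewrite mulmxBr mulmxBl !map_mxM; congr (_ - _).
  by rewrite mul_mx_scalar -scalemxAl invPP scalemx1.
by rewrite !det_mulmx mulrAC -det_mulmx invPP det1 mul1r.
Qed.

(** By the spectral theorem [A] is conjugate to a diagonal matrix, so both sequences list the roots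
    of one characteristic polynomial. *)
Lemma eigenvalues_hermitian (C : numClosedFieldType) n (A : 'M[C]_n) :
  A \is hermsymmx ->
  perm_eq (eigenvalues A) [seq spectral_diag A 0 i | i : 'I_n].
Proof.
move=> /hermitian_normalmx/orthomx_spectralP defA; apply: prod_XsubC_eq.
have Punit : spectralmx A \in unitmx.
  exact/unitarymx_unit/spectral_unitarymx.
rewrite /eigenvalues; case: closed_field_poly_normal => rs /= defp.
transitivity (char_poly A).
  by rewrite {1}defp (monicP (char_poly_monic A)) scale1r.
rewrite {1}defA char_poly_invmx_conj // char_poly_trig ?diag_mx_is_trig //.
rewrite big_image /=; apply: eq_bigr => i _.
by rewrite mxE eqxx.
Qed.

Lemma mxtrace_hermitian_sqr (C : numClosedFieldType) n (A : 'M[C]_n) :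
  A \is hermsymmx -> \tr (A *m A) = \sum_i `|spectral_diag A 0 i| ^+ 2.
Proof.
move=> herA; have /orthomx_spectralP defA := hermitian_normalmx herA.
have Punit : spectralmx A \in unitmx.
  exact/unitarymx_unit/spectral_unitarymx.
have /mxOverP spR := hermitian_spectral_diag_real herA.
rewrite {1 2}defA -!mulmxA mxtrace_mulC -!mulmxA mulmxV // mulmx1 mulKVmx //.
rewrite mulmx_diag mxtrace_diag; apply: eq_bigr => i _.
by rewrite mxE real_normK // expr2.
Qed.

(** The eigenvalues are real and turn out to have modulus sqrt d, so [A *m A] is conjugate to a
    scalar matrix and hence equal to it. *)
Lemma optimal_hermitian_sqr (C : numClosedFieldType) n (A : 'M[C]_n) (d : nat) :
  A \is hermsymmx -> \tr (A *m A) <= n%:R * d%:R ->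
  \sum_(z <- eigenvalues A) `|z| = n%:R * sqrtC d%:R -> A *m A = d%:R%:M.
Proof.
move=> herA trA; rewrite (perm_big _ (eigenvalues_hermitian herA)) big_image /=.
move=> energyA; have /orthomx_spectralP defA := hermitian_normalmx herA.
have Punit : spectralmx A \in unitmx.
  exact/unitarymx_unit/spectral_unitarymx.
have /mxOverP spR := hermitian_spectral_diag_real herA.
have sqrtR : sqrtC (d%:R : C) \is Num.real.
  by rewrite ger0_real // sqrtC_ge0 ler0n.
(* The equality case of Cauchy-Schwarz, as a vanishing sum of squares. *)
have dev0 : \sum_i (`|spectral_diag A 0 i| - sqrtC d%:R) ^+ 2 = 0.
  apply/eqP; rewrite eq_le; apply/andP; split; last first.
    by apply: sumr_ge0 => i _; rewrite real_exprn_even_ge0 // rpredB // normr_real.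
  (* The expanded sum is tr A^2 - 2 n d + n d, at most 0 by the trace bound. *)
  under eq_bigr do rewrite sqrrB sqrtCK.
  rewrite big_split /= big_split /= sumrN sumrMnl -mulr_suml.
  rewrite energyA -mulrA -expr2 sqrtCK -mxtrace_hermitian_sqr //.
  rewrite sumr_const card_ord -[d%:R *+ n]mulr_natl mulr2n opprD addrA.
  by rewrite subrK subr_le0.
have sp2 i : spectral_diag A 0 i * spectral_diag A 0 i = d%:R.
  have /eqP := dev0; rewrite psumr_eq0 => [/allP/(_ i)|j _]; last first.
    by rewrite real_exprn_even_ge0 // rpredB // normr_real.
  rewrite mem_index_enum => /(_ isT) /=; rewrite expf_eq0 /= subr_eq0.
  by move=> /eqP spi; rewrite -expr2 -real_normK // spi sqrtCK.
rewrite {1 2}defA -!mulmxA (mulKVmx Punit) [diag_mx _ *m (_ *m _)]mulmxA.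
rewrite mulmx_diag; set D := diag_mx _.
have -> : D = d%:R%:M.
  by apply/matrixP=> i j; rewrite !mxE sp2.
by rewrite mul_scalar_mx -scalemxAr mulVmx ?scalemx1.
Qed.

Lemma sum_enum_val (V : nmodType) (T : finType) (F : T -> V) :
  \sum_(i < #|T|) F (enum_val i) = \sum_x F x.
Proof. by rewrite -(big_enum_val F); apply: eq_bigl => x; rewrite inE. Qed.

(** * The Hermitian-adjacency matrix and its square *)

Section HermAdj.
Variables (C : numClosedFieldType) (G : sgraph) (phi : orientation G).
Local Notation H := (herm_adj C phi).

(** Indexed by vertices instead of ranks, with the orientation isolated in a sign. *)
Definition hentry (u v : G) : C :=
  if edge u v then (-1) ^+ (~~ arc phi u v) * 'i else 0.

Lemma arcC u v : edge u v -> arc phi v u = ~~ arc phi u v.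
Proof.
rewrite (arc_edge phi); have := arc_asym phi u v.
by case: (arc phi u v); case: (arc phi v u).
Qed.

Lemma herm_adjE k l : H k l = hentry (enum_val k) (enum_val l).
Proof.
rewrite mxE /hentry (arc_edge phi).
case: (arc phi (enum_val k) _) => /=; first by rewrite mul1r.
by case: ifP; rewrite // mulN1r.
Qed.

Lemma hentryC u v : hentry v u = (hentry u v)^*.
Proof.
rewrite /hentry edge_sym; case: ifPn => [uv|_]; last by rewrite rmorph0.
rewrite (arcC uv) rmorphM /= conjCi rmorphXn /= rmorphN1.
by case: (arc phi u v); rewrite /= !(mul1r, mulN1r, opprK).
Qed.

Lemma herm_adj_hermitian : H \is hermsymmx.
Proof.
apply/is_hermitianmxP; rewrite expr0 scale1r; apply/matrixP=> k l.
by rewrite [RHS]mxE [X in _ = _ X]mxE !herm_adjE hentryC.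
Qed.

Lemma hentry_mulC u v : hentry u v * hentry v u = (edge u v)%:R.
Proof.
rewrite [hentry v u]hentryC -normCK /hentry; case: ifP => _; last by rewrite normr0 expr0n.
by rewrite normrM normrX normrN1 expr1n mul1r normCi expr1n.
Qed.

(** Since h_uv h_vu = |h_uv|^2, the diagonal entries of H^2 are the degrees. *)
Lemma mxtrace_herm_adj_sqr :
  \tr (H *m H) <= #|G|%:R * (max_degree G)%:R.
Proof.
have -> : \tr (H *m H) = \sum_(i < #|G|) (degree (enum_val i))%:R.
  apply: eq_bigr => i _; rewrite mxE.
  under eq_bigr do rewrite !herm_adjE hentry_mulC.
  rewrite (sum_enum_val (fun v => (edge (enum_val i) v)%:R)) /degree.
  rewrite -sum1dep_card natr_sum [RHS]big_mkcond.
  by apply: eq_bigr => v _; case: ifP.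
rewrite mulr_natl -[n in _ *+ n]card_ord -sumr_const; apply: ler_sum => i _.
by rewrite ler_nat (leq_bigmax (F := @degree G)).
Qed.

Lemma optimum_herm_adj_sqr : optimum_energy C phi ->
  H *m H = (max_degree G)%:R%:M.
Proof.
exact: optimal_hermitian_sqr herm_adj_hermitian mxtrace_herm_adj_sqr.
Qed.

Lemma optimum_common_neighbours u w : optimum_energy C phi -> u != w ->
  \sum_v hentry u v * hentry v w = 0.
Proof.
move=> /optimum_herm_adj_sqr/matrixP/(_ (enum_rank u) (enum_rank w)) + uw.
rewrite !mxE (inj_eq enum_rank_inj) (negPf uw) mulr0n => HH0; rewrite -[RHS]HH0.
under [RHS]eq_bigr do rewrite !herm_adjE !enum_rankK.
by rewrite (sum_enum_val (fun v => hentry u v * hentry v w)).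
Qed.

End HermAdj.

(** * Squares, common neighbours and potentials *)

Definition square (G : sgraph) (u v w x : G) : Prop :=
  [/\ [&& edge u v, edge v w, edge u x & edge x w], u != w & v != x].

Definition few_common_neighbours (G : sgraph) : Prop :=
  forall u v w x y : G, square u v w x -> edge u y -> edge y w ->
  y = v \/ y = x.

(** Only [v] and [x] contribute to the (u, w) entry of H^2. Each contributes 1 or -1 according to
    the parity of its two arcs, and the two terms must cancel. *)
Lemma optimum_square (C : numClosedFieldType) (G : sgraph)
    (phi : orientation G) (u v w x : G) :
  few_common_neighbours G -> optimum_energy C phi -> square u v w x ->
  arc phi u v (+) arc phi v w (+) arc phi u x (+) arc phi x w.
Proof.
move=> fcnG optG sq; have [/and4P[uv vw ux xw] uw vx] := sq.
have := optimum_common_neighbours optG uw.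
rewrite (bigD1 v) //= (bigD1 x) 1?eq_sym //= big1 ?addr0 => [|y].
  have i2N1 : 'i * 'i = -1 :> C by rewrite -expr2 sqrCi.
  have N2neq0 : (-1 - 1 : C) != 0 by rewrite -opprD oppr_eq0 (pnatr_eq0 _ 2).
  have two_neq0 : (1 + 1 : C) != 0 by rewrite (pnatr_eq0 _ 2).
  rewrite /hentry uv vw ux xw => /eqP.
  case: (arc phi u v); case: (arc phi v w); case: (arc phi u x);
    case: (arc phi x w); rewrite //= ?(mul1r, mulN1r, mulrN, mulNr, opprK) i2N1;
    by rewrite ?opprK ?(negPf N2neq0) ?(negPf two_neq0).
move=> /andP[yv yx]; rewrite /hentry.
case: ifP => uy; last by rewrite mul0r.
case: ifP => yw; last by rewrite mulr0.
by case: (fcnG _ _ _ _ _ sq uy yw) => y_eq; move: yv yx; rewrite y_eq eqxx.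
Qed.

(** With signs written as booleans under xor: an edge cochain mod 2 that vanishes on squares is a
    coboundary. *)
Definition balanced (G : sgraph) : Prop :=
  forall s : rel G, (forall u v, edge u v -> s u v = s v u) ->
  (forall u v w x, square u v w x -> s u v (+) s v w = s u x (+) s x w) ->
  exists d : G -> bool, forall u v, edge u v -> s u v = d u (+) d v.

Lemma ord2_neq (b c e : 'I_2) : b != c -> c != e -> b = e.
Proof.
by case: b c e => [[|[|//]] ?] [[|[|//]] ?] [[|[|//]] ?] // _ _; apply/val_inj.
Qed.

(** * Passing from a graph to its product with K_2 *)

Section Prism.
Variable G : sgraph.
Local Notation prism := (cart_prod G (complete_graph 2)).

Lemma prism_edgeP (u v : G) (b c : 'I_2) :
  reflect (u = v /\ b != c \/ b = c /\ edge u v)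
          (edge ((u, b) : prism) (v, c)).
Proof.
apply: (iffP orP) => -[] /=.
- by case/andP=> /eqP; left.
- by case/andP=> /eqP; right.
- by case=> ->; rewrite eqxx; left.
- by case=> ->; rewrite eqxx; right.
Qed.

(** The ends are on one level, so the number of vertical steps is even; two of them would give
    [u = w]. *)
Lemma prism_path2_flat (u v w : G) (b c : 'I_2) : u != w ->
  edge ((u, b) : prism) (v, c) -> edge ((v, c) : prism) (w, b) ->
  [/\ c = b, edge u v & edge v w].
Proof.
move=> uw /prism_edgeP[[uv bc]|[<- uv]] /prism_edgeP[[vw cb]|[cb vw]] //.
- by rewrite uv vw eqxx in uw.
- by rewrite cb eqxx in bc.
- by rewrite eqxx in cb.
Qed.

(** Exactly one of the two steps is vertical, and its place decides the midpoint. *)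
Lemma prism_path2_steep (u v w : G) (b c e : 'I_2) : b != e ->
  edge ((u, b) : prism) (v, c) -> edge ((v, c) : prism) (w, e) ->
  (v, c) = (w, b) \/ (v, c) = (u, e).
Proof.
move=> be /prism_edgeP[[-> bc]|[<- uv]] /prism_edgeP[[<- ce]|[ce vw]].
- by rewrite (ord2_neq bc ce) eqxx in be.
- by right; rewrite ce.
- by left.
- by rewrite ce eqxx in be.
Qed.

Lemma few_common_neighbours_prism :
  few_common_neighbours G -> few_common_neighbours prism.
Proof.
move=> fcnG [u b] [v c] [w e] [x f] [y g] [/and4P[uv vw ux xw] uw vx] uy yw.
have [be|be] := eqVneq b e.
  subst e; have {}uw : u != w by apply: contra uw => /eqP ->.
  have [cb uv' vw'] := prism_path2_flat uw uv vw.
  have [fb ux' xw'] := prism_path2_flat uw ux xw.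
  have [gb uy' yw'] := prism_path2_flat uw uy yw.
  subst c f g; have {}vx : v != x by apply: contra vx => /eqP ->.
  have sq : square u v w x by split=> //; apply/and4P.
  by case: (fcnG _ _ _ _ _ sq uy' yw') => ->; [left | right].
(* The midpoints [v], [x] and [y] share two possible values, and [v], [x] already take both. *)
move: vx.
case: (prism_path2_steep be uv vw) => ->;
  case: (prism_path2_steep be ux xw) => ->;
  case: (prism_path2_steep be uy yw) => ->; rewrite ?eqxx //; by [left|right].
Qed.

Lemma balanced_prism : balanced G -> balanced prism.
Proof.
move=> balG s sC sq.
have edge_h x y (b : 'I_2) : edge x y -> edge ((x, b) : prism) (y, b).
  by move=> xy; apply/prism_edgeP; right.
have edge_v x (b c : 'I_2) : b != c -> edge ((x, b) : prism) (x, c).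
  by move=> bc; apply/prism_edgeP; left.
have [||d dP] := balG (fun x y => s (x, ord0) (y, ord0)).
- by move=> x y xy; apply/sC/edge_h.
- move=> u v w x [/and4P[uv vw ux xw] uw vx]; apply: sq; split.
  + by rewrite !edge_h.
  + by apply: contra uw => /eqP[->].
  + by apply: contra vx => /eqP[->].
(* The values off the layer [ord0] are forced by the vertical edges. *)
pose d' (z : prism) := d z.1 (+) ((z.2 != ord0) && s (z.1, ord0) z).
exists d' => -[x b] [y c] /prism_edgeP[[<- bc]|[<- xy]]; rewrite /d' /=.
  rewrite addbACA addbb addFb; case: (eqVneq b ord0) bc => [-> | b0] bc.
    by rewrite eq_sym bc.
  have -> : c = ord0 by apply/esym/(ord2_neq _ bc); rewrite eq_sym.
  by rewrite /= addbF; apply/sC/edge_v.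
case: eqVneq => [-> | b0] /=; first by rewrite !addbF dP.
(* An edge of the other layer forms a square with two vertical edges and its copy in the layer
   [ord0], where [d] is a potential. *)
have /sq : square ((x, b) : prism) (x, ord0) (y, ord0) (y, b).
  split.
  - by rewrite !(edge_v, edge_h).
  - by apply: contra b0 => /eqP[_ ->].
  - by apply: contra b0 => /eqP[_ ->].
rewrite dP // (sC (x, b)) ?edge_v // (sC (y, b) (y, ord0)) ?edge_v //.
by case: (s _ _); case: (s _ _); case: (s _ _); case: (d x); case: (d y).
Qed.

End Prism.

Lemma hypercube_squares k : (0 < k)%N ->
  few_common_neighbours (hypercube k) /\ balanced (hypercube k).
Proof.
case: k => // k _; elim: k => [|k [fcn bal]]; last first.
  by split; [apply: few_common_neighbours_prism | apply: balanced_prism].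
(* In K_2 a path of length two returns to its start, so there are no squares. *)
split=> [u v w x y [/and4P[uv vw _ _] uw _]|s sC _].
  by rewrite (ord2_neq uv vw) eqxx in uw.
(* The potential is 0 at [ord0] and equals [s] of the single edge at the other vertex. *)
exists (fun u : 'I_2 => (u != ord0) && s ord0 u) => u v uv.
have [u0|u0] := eqVneq u ord0.
  by subst u; have v0 : (v : 'I_2) != ord0; rewrite /= ?v0 // eq_sym.
have v0 : ord0 = v by apply: ord2_neq uv; rewrite eq_sym.
by subst v; rewrite /= addbF sC.
Qed.

(** * From potentials to switching equivalence *)

Lemma switching_of_coboundary (C : numClosedFieldType) (G : sgraph)
    (phi1 phi2 : orientation G) (d : G -> bool) :
  (forall u v, edge u v -> arc phi1 u v (+) arc phi2 u v = d u (+) d v) ->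
  switching_equivalent C phi1 phi2.
Proof.
(* Conjugation by this matrix, its own inverse, multiplies the (u, v) entry by (-1)^(d u + d v), the
   sign by which the two orientations differ. *)
move=> dP; pose D : 'rV[C]_#|G| := \row_j (-1) ^+ d (enum_val j).
have DD : diag_mx D *m diag_mx D = 1%:M.
  by rewrite mulmx_diag; apply/matrixP=> i j; rewrite !mxE -signr_addb addbb.
have [Dunit _] := mulmx1_unit DD.
exists (diag_mx D); split; first exact: diag_mx_is_diag.
  by move=> j; rewrite !mxE eqxx mulr1n; case: (d _); [right | left].
rewrite -mulmxA; apply: (canRL (mulKmx Dunit)).
rewrite mul_diag_mx mul_mx_diag; apply/matrixP=> i j.
rewrite [LHS]mxE [RHS]mxE !herm_adjE !mxE /hentry.
case: ifPn => [/dP|_]; last by rewrite mulr0 mul0r.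
case: (arc phi1 _ _); case: (arc phi2 _ _); case: (d _); case: (d _) => //= _;
  by rewrite !(mulN1r, mul1r, mulrN, mulrN1, mulr1, opprK).
Qed.

Theorem theorem4p4 (C : numClosedFieldType) (k : nat) (k_gt0 : (0 < k)%N)
    (phi1 phi2 : orientation (hypercube k)) :
  optimum_energy C phi1 -> optimum_energy C phi2 ->
  switching_equivalent C phi1 phi2.
Proof.
move=> opt1 opt2; have [fcn bal] := hypercube_squares k_gt0.
have [||d dP] := bal (fun u v => arc phi1 u v (+) arc phi2 u v).
- by move=> u v uv; rewrite !(arcC _ uv) addbN addNb negbK.
- move=> u v w x sq.
  (* Both orientations have odd parity on the square, so their difference has even parity. *)
  have := optimum_square fcn opt1 sq; have := optimum_square fcn opt2 sq.
  by do 8!case: (arc _ _ _).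
exact: switching_of_coboundary dP.
Qed.
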